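(* Let $G=(V,E)$ be a finite strongly connected directed graph (loops and multiple arcs allowed), let $s\in V$ and let $T\subseteq V$ be nonempty such that every arc leaving a vertex of $T$ ends at $s$. Fix at every vertex $v$ a rotor mechanism $e_v^1,\dots,e_v^{d(v)}$ (an ordering of the arcs leaving $v$, extended periodically with period $d(v)$), and let $(t_n)_{n\ge1}$ be the associated hitting sequence. Let the reversed rotor mechanism at $v$ be $f_v^i=e_v^{d(v)+1-i}$ for $1\le i\le d(v)$ (extended periodically with period $d(v)$), and let $(t'_n)_{n\ge1}$ be the hitting sequence associated with the reversed mechanisms. If $D\ge1$ satisfies $t_{n+D}=t_n$ for all $n\ge1$, then $t'_{n+D}=t'_n$ for all $n\ge 1$, and $t'_i=t_{D+1-i}$ for all $1\le i\le D$.
   Context: $d(v)$ is the out-degree of $v$ and $v^i$ is the head of the $i$-th arc of the mechanism at $v$. Given rotor mechanisms at all vertices, the rotor walk from $s$ is the infinite sequence $x_0=s,x_1,\dots$ in which, for every vertex $v$ and $i\ge1$, the $i$-th occurrence of $v$ is immediately followed by $v^i$; the hitting sequence is the subsequence of terms of the rotor walk that lie in $T$. *)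

(* Defs.v *)
From mathcomp Require Import all_boot.
From Stdlib Require Classical_Prop.

Set Implicit Arguments.
Unset Strict Implicit.
Unset Printing Implicit Defensive.

(* A finite directed multigraph is given by finite types V of vertices and E
   of arcs, with the source src a and the target tgt a of each arc a.
   Mechanisms and hitting sequences are indexed from 1 (their values at 0 are
   irrelevant); walks are indexed from 0. *)

Definition out_arcs (V E : finType) (src : E -> V) (v : V) : {set E} :=
  [set a | src a == v].

Definition outdeg (V E : finType) (src : E -> V) (v : V) : nat :=
  #|out_arcs src v|.

Definition arc_rel (V E : finType) (src tgt : E -> V) : rel V :=
  [rel u v | [exists a, (src a == u) && (tgt a == v)]].

Definition strongly_connected (V E : finType) (src tgt : E -> V) : Prop :=
  forall u v : V, connect (arc_rel src tgt) u v.

(* e v i is the arc e_v^i. *)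
Definition rotor_mechanism (V E : finType) (src : E -> V)
    (e : V -> nat -> E) : Prop :=
  forall v : V,
    perm_eq [seq e v i | i <- iota 1 (outdeg src v)] (enum (out_arcs src v)) /\
    forall i, 1 <= i -> e v (i + outdeg src v) = e v i.

(* (i - 1) %% outdeg src v + 1 is the representative of i modulo outdeg src v
   in {1, ..., outdeg src v}. *)
Definition reversed_mechanism (V E : finType) (src : E -> V)
    (e : V -> nat -> E) (v : V) (i : nat) : E :=
  e v (outdeg src v + 1 - ((i - 1) %% outdeg src v + 1)).

(* The initial segment [:: x_0; ...; x_n] of the rotor walk: the last vertex v
   of x_0, ..., x_m is there at its (count_mem v)-th occurrence. *)
Fixpoint rotor_prefix (V E : finType) (tgt : E -> V) (e : V -> nat -> E)
    (s : V) (n : nat) : seq V :=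
  if n is m.+1 then
    let p := rotor_prefix tgt e s m in
    let v := last s p in
    rcons p (tgt (e v (count_mem v p)))
  else [:: s].

Definition rotor_walk (V E : finType) (tgt : E -> V) (e : V -> nat -> E)
    (s : V) (n : nat) : V :=
  last s (rotor_prefix tgt e s n).

(* t is the subsequence of the terms of x that lie in T; tau n is the time of
   the n-th visit to T. *)
Definition is_hitting_sequence (V : finType) (x : nat -> V) (T : {set V})
    (t : nat -> V) : Prop :=
  exists tau : nat -> nat,
    [/\ forall m n, 1 <= m -> m < n -> tau m < tau n,
        forall k, x k \in T <-> exists2 n, 1 <= n & tau n = k &
        forall n, 1 <= n -> t n = x (tau n)].

(* The facts below justify the definitions: the walk is characterised by "the
   i-th occurrence of v is followed by v^i", the reversal of a mechanism is a
   mechanism, and hitting sequences exist (rotor_hitting_exists) and are unique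
   (is_hitting_sequence_uniq). *)

Lemma iota0Sr n : iota 0 n.+1 = rcons (iota 0 n) n.
Proof. by rewrite -addn1 iotaD cats1. Qed.

Lemma rotor_prefixE (V E : finType) (tgt : E -> V) e s n :
  rotor_prefix tgt e s n = [seq rotor_walk tgt e s k | k <- iota 0 n.+1].
Proof.
elim: n => [//|n IHn].
by rewrite iota0Sr map_rcons -IHn /rotor_walk /= last_rcons.
Qed.

Lemma rotor_walk0 (V E : finType) (tgt : E -> V) e s :
  rotor_walk tgt e s 0 = s.
Proof. by []. Qed.

Lemma rotor_walkS (V E : finType) (tgt : E -> V) e s n :
  let x := rotor_walk tgt e s in
  x n.+1 = tgt (e (x n) (count_mem (x n) [seq x k | k <- iota 0 n.+1])).
Proof.
move=> x; rewrite /x -[[seq _ | k <- _]]rotor_prefixE /rotor_walk.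
by rewrite [rotor_prefix _ _ _ n.+1]/= last_rcons.
Qed.

Lemma reversed_mechanismE (V E : finType) (src : E -> V) e v i :
    1 <= i <= outdeg src v ->
  reversed_mechanism src e v i = e v (outdeg src v + 1 - i).
Proof.
case/andP=> i1 id; rewrite /reversed_mechanism modn_small ?subnK //.
by rewrite subn1 prednK.
Qed.

Lemma reversed_mechanismP (V E : finType) (src : E -> V) e :
  rotor_mechanism src e -> rotor_mechanism src (reversed_mechanism src e).
Proof.
move=> He v; have [Hp _] := He v; split; last first.
  by move=> i i1; rewrite /reversed_mechanism -(addnBAC _ i1) modnDr.
apply: perm_trans Hp; set d := outdeg src v.
have -> : [seq reversed_mechanism src e v i | i <- iota 1 d] =
          rev [seq e v i | i <- iota 1 d].
  apply: (@eq_from_nth _ (e v 0)); rewrite ?size_rev ?size_map ?size_iota //.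
  move=> i id; rewrite nth_rev ?size_map ?size_iota //.
  have id' : d - i.+1 < d by rewrite subnSK // leq_subr.
  rewrite !(nth_map 0) ?size_iota // !nth_iota //.
  by rewrite reversed_mechanismE ?add1n //= addn1 subSS subnSK.
by rewrite perm_rev.
Qed.

Lemma walk_count (V : finType) (x : nat -> V) v j n :
    0 < j -> j <= count_mem v [seq x k | k <- iota 0 n] ->
  exists m, x m = v /\ count_mem v [seq x k | k <- iota 0 m.+1] = j.
Proof.
move=> j0; elim: n => [|n IHn]; first by rewrite leqNgt j0.
have [/IHn//|lt] := leqP j (count_mem v [seq x k | k <- iota 0 n]).
move=> le; rewrite iota0Sr map_rcons -cats1 count_cat /= addn0 in le.
case: (x n =P v) le => [xn le|_]; last by rewrite addn0 leqNgt lt.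
exists n; split; first exact: xn.
rewrite iota0Sr map_rcons -cats1 count_cat /= addn0 xn eqxx.
by apply/eqP; rewrite eqn_leq le andbT addn1.
Qed.

Lemma count_unbounded (V : finType) (x : nat -> V) v N :
    (forall M, exists2 n, M <= n & x n = v) ->
  exists n, N <= count_mem v [seq x k | k <- iota 0 n].
Proof.
move=> H; elim: N => [|N [n Hn]]; first by exists 0.
have [m le xm] := H n; exists m.+1.
rewrite iota0Sr map_rcons -cats1 count_cat /= xm eqxx addn1 ltnS.
apply: leq_trans Hn _.
by rewrite -(subnKC le) iotaD map_cat count_cat leq_addr.
Qed.

Lemma rotor_walk_recurrent (V E : finType) (src tgt : E -> V) e s :
    strongly_connected src tgt -> rotor_mechanism src e ->
  forall v N, exists2 n, N <= n & rotor_walk tgt e s n = v.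
Proof.
move=> Hc He; set x := rotor_walk tgt e s.
have [v0 Hv0] : exists v, forall N, exists2 n, N <= n & x n = v.
  apply: Classical_Prop.NNPP => Hno.
  have HB v : exists N, forall n, N <= n -> x n != v.
    apply: Classical_Prop.NNPP => Hv; apply: Hno; exists v => N.
    apply: Classical_Prop.NNPP => HN; apply: Hv; exists N => n le.
    by apply/eqP => xn; apply: HN; exists n.
  have [B HBB] := fin_all_exists HB.
  have := HBB (x (\max_v B v)) (\max_v B v).
  by rewrite eqxx => /(_ (leq_bigmax _)).
have step u w : arc_rel src tgt u w ->
    (forall N, exists2 n, N <= n & x n = u) ->
    forall N, exists2 n, N <= n & x n = w.
  case/existsP=> a /andP[/eqP au /eqP aw] Hu N.
  have [Hp Hper] := He u.
  have : a \in [seq e u i | i <- iota 1 (outdeg src u)].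
    by rewrite (perm_mem Hp) mem_enum inE au.
  case/mapP=> i; rewrite mem_iota => /andP[i1 id] ai.
  have d0 : 0 < outdeg src u by rewrite -ltnS -add1n; apply: leq_ltn_trans id.
  have Hk k : e u (i + k * outdeg src u) = a.
    elim: k => [|k IHk]; first by rewrite addn0.
    rewrite mulSn addnCA addnC Hper ?IHk //.
    exact: leq_trans i1 (leq_addr _ _).
  pose j := i + N * outdeg src u.
  have [n Hn] := count_unbounded j Hu.
  have j0 : 0 < j by apply: leq_trans i1 (leq_addr _ _).
  have [m [xm cm]] := walk_count j0 Hn.
  exists m.+1; last by rewrite /x rotor_walkS -/x xm cm Hk.
  have : j <= m.+1.
    rewrite -cm; apply: leq_trans (count_size _ _) _.
    by rewrite size_map size_iota.
  apply: leq_trans; apply: leq_trans (leq_addl _ _).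
  exact: leq_pmulr.
move=> v; have /connectP[p] := Hc v0 v.
elim: p v0 Hv0 => [|w p IHp] v0 Hv0 /=; first by move=> _ ->.
by case/andP=> /step Hs Hp; apply: IHp Hp; apply: Hs.
Qed.

Lemma is_hitting_sequence_exists (V : finType) (x : nat -> V) (T : {set V}) :
    (forall N, exists2 n, N <= n & x n \in T) ->
  exists t, is_hitting_sequence x T t.
Proof.
move=> H.
have H' N : exists n, (N <= n) && (x n \in T).
  by have [n le xn] := H N; exists n; rewrite le.
pose nxt N := ex_minn (H' N).
have nxt_ge N : N <= nxt N by rewrite /nxt; case: ex_minnP => n /andP[].
have nxt_in N : x (nxt N) \in T by rewrite /nxt; case: ex_minnP => n /andP[].
have nxt_min N n : N <= n -> x n \in T -> nxt N <= n.
  by move=> le xn; rewrite /nxt; case: ex_minnP => m _; apply; rewrite le.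
pose tau := fix f n := if n is m.+1 then
  (if m is 0 then nxt 0 else nxt (f m).+1) else 0.
have tauS n : 1 <= n -> tau n.+1 = nxt (tau n).+1 by case: n.
have tau_in n : 1 <= n -> x (tau n) \in T.
  by case: n => // -[|n] _; exact: nxt_in.
have tau_lt n : 1 <= n -> tau n < tau n.+1 by move=> n1; rewrite tauS.
have tau_mono m n : 1 <= m -> m < n -> tau m < tau n.
  move=> m1; elim: n => [//|n IHn]; rewrite ltnS leq_eqVlt => /orP[/eqP<-|lt].
    exact: tau_lt.
  exact: ltn_trans (IHn lt) (tau_lt _ (leq_trans m1 (ltnW lt))).
have tau_ge n : n <= (tau n.+1).
  elim: n => [//|n IHn]; exact: leq_ltn_trans IHn (tau_lt _ _).
exists (fun n => x (tau n)), tau; split=> // k; split=> [xk|[n n1 <-]]; last first.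
  exact: tau_in.
have : exists n, k <= tau n.+1 by exists k.
case/ex_minnP=> n le min; exists n.+1 => //.
apply/eqP; rewrite eqn_leq le andbT.
case: n le min => [|n] le min; first exact: nxt_min.
rewrite tauS //; apply: nxt_min => //; rewrite ltnNge; apply/negP => /min.
by rewrite ltnn.
Qed.

Lemma rotor_hitting_exists (V E : finType) (src tgt : E -> V) s (T : {set V}) e :
    strongly_connected src tgt -> T != set0 -> rotor_mechanism src e ->
  exists t, is_hitting_sequence (rotor_walk tgt e s) T t.
Proof.
move=> Hc /set0Pn[v vT] He; apply: is_hitting_sequence_exists => N.
have [n le xn] := rotor_walk_recurrent s Hc He v N.
by exists n => //; rewrite xn.
Qed.

Lemma is_hitting_sequence_uniq (V : finType) (x : nat -> V) (T : {set V}) t1 t2 :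
    is_hitting_sequence x T t1 -> is_hitting_sequence x T t2 ->
  forall n, 1 <= n -> t1 n = t2 n.
Proof.
case=> [tau1 [mono1 range1 E1]] [tau2 [mono2 range2 E2]].
suff le (f g : nat -> nat) :
    (forall m n, 1 <= m -> m < n -> f m < f n) ->
    (forall m n, 1 <= m -> m < n -> g m < g n) ->
    (forall n, 1 <= n -> exists2 m, 1 <= m & f m = g n) ->
    forall n, 1 <= n -> f n <= g n.
  move=> n n1; rewrite E1 // E2 //; congr x.
  apply/eqP; rewrite eqn_leq; apply/andP; split; apply: le => // m m1.
  - by apply/range1/range2; exists m.
  - by apply/range2/range1; exists m.
move=> Hf Hg Hr n n1.
suff [m nm <-] : exists2 m, n <= m & f m = g n.
  by move: nm; rewrite leq_eqVlt => /orP[/eqP->//|/(Hf _ _ n1)/ltnW].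
elim: n n1 => [//|[|n] IHn] _; first exact: Hr.
have [m nm fm] := IHn isT.
have [k k1 fk] := Hr n.+2 isT; exists k => //.
apply: leq_ltn_trans nm _; rewrite ltnNge; apply/negP.
have := Hg n.+1 n.+2 isT (ltnSn _); rewrite -fm -fk => lt.
rewrite leq_eqVlt => /orP[/eqP ekm|/(Hf _ _ k1) lt']; first by rewrite ekm ltnn in lt.
by have := ltn_trans lt lt'; rewrite ltnn.
Qed.

(* Main.v *)
(* Call [u : V -> nat] a circulation if firing each vertex [v] exactly [u v]
   times sends [u v] chips into each [v]. Stopping the rotor walk just after its
   [n]-th hit gives a circulation of total mass [n] on [T]. By a least-action
   argument every circulation of mass [n] on [T] dominates it, and so agrees
   with it on [T]: any such circulation counts the first [n] hits. Pigeonhole on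
   the states of the walk gives arbitrarily large circulations [W], made of full
   turns of all rotors, whose mass [N] on [T] is divisible by [D]. If [u] counts
   the first [n] reversed hits, then [W - u] is a circulation for the original
   mechanisms, because the last [u v] arcs of [W v] arcs in full turns are the
   first [u v] reversed ones. Hence the first [n] reversed hits complement the
   first [N - n] original ones, and [t' n = t (N + 1 - n)]. *)
Require Import Defs.
From mathcomp Require Import all_boot zify.
From Stdlib Require Classical_Prop.

Set Implicit Arguments.
Unset Strict Implicit.
Unset Printing Implicit Defensive.

(** * Chip balance of the rotor walk *)

Definition visits (V : finType) (x : nat -> V) (m : nat) (v : V) : nat :=
  \sum_(k < m) (x k == v).

Definition inflow (V E : finType) (tgt : E -> V) (e : V -> nat -> E)
    (u : V -> nat) (v : V) : nat :=
  \sum_w \sum_(i < u w) (tgt (e w i.+1) == v).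

Lemma visitsS (V : finType) (x : nat -> V) m v :
  visits x m.+1 v = visits x m v + (x m == v).
Proof. by rewrite /visits big_ord_recr. Qed.

Lemma leq_visits (V : finType) (x : nat -> V) m n v :
  m <= n -> visits x m v <= visits x n v.
Proof.
by move/subnKC<-; elim: (n - m) => [|k IHk]; rewrite ?addn0 // addnS visitsS; lia.
Qed.

Lemma count_mem_visits (V : finType) (x : nat -> V) m v :
  count_mem v [seq x k | k <- iota 0 m] = visits x m v.
Proof.
elim: m => [|m IHm]; first by rewrite /visits big_ord0.
by rewrite iota0Sr map_rcons -cats1 count_cat IHm visitsS /= addn0.
Qed.

Lemma sum_pointwise (V : finType) (P : pred V) (a : V) (F : V -> nat) :
  P a -> \sum_(v | P v) (a == v) * F v = F a.
Proof.
move=> Pa; rewrite (bigD1 a) //= eqxx mul1n big1 ?addn0 // => v /andP[_ va].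
by rewrite eq_sym (negPf va).
Qed.

Lemma sum_ord_subn (F : nat -> nat) m n : m <= n ->
  \sum_(i < n) F i = \sum_(i < n - m) F i + \sum_(i < m) F (n - m + i).
Proof.
move=> mn; rewrite -(big_mkord xpredT F) -{1}(subnK mn) big_mkord.
by rewrite big_split_ord.
Qed.

(** The walk carries a single chip from [s] to its current vertex, and each vertex has sent it along
    its arcs in order; only the two ends unbalance the flow. *)
Lemma rotor_walk_inflow (V E : finType) (tgt : E -> V) e s m v :
  inflow tgt e (visits (rotor_walk tgt e s) m) v + (s == v) =
    visits (rotor_walk tgt e s) m v + (rotor_walk tgt e s m == v).
Proof.
set x := rotor_walk tgt e s; elim: m => [|m IHm].
  rewrite /inflow /visits big1 ?big_ord0 // => w _.
  by rewrite !big_ord0.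
rewrite visitsS -IHm.
suff -> : inflow tgt e (visits x m.+1) v =
          inflow tgt e (visits x m) v + (x m.+1 == v) by rewrite addnAC.
have -> : x m.+1 = tgt (e (x m) (visits x m (x m)).+1).
  by rewrite /x rotor_walkS -/x count_mem_visits visitsS eqxx addn1.
rewrite -[nat_of_bool (tgt _ == v)](sum_pointwise
  (fun w => (tgt (e w (visits x m w).+1) == v) : nat) (erefl (xpredT (x m)))).
rewrite -big_split; apply: eq_bigr => w _ /=.
rewrite visitsS; case: eqP => _; last by rewrite addn0 mul0n addn0.
by rewrite addn1 big_ord_recr mul1n.
Qed.

(* The walk cannot overtake a circulation [u]: if it leaves [v] for the
   [(u v).+1]-st time, then [v = s] and every arc into [s] that [u] uses is
   used up, in particular those leaving [T]. *)
Lemma visits_le_circulation (V E : finType) (src tgt : E -> V) s (T : {set V})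
    e u :
    (forall a, src a \in T -> tgt a = s) ->
    (forall v i, src (e v i.+1) = v) ->
    (forall v, inflow tgt e u v = u v) ->
  forall M,
    (forall m, m < M -> \sum_(v in T) visits (rotor_walk tgt e s) m v <
                        \sum_(v in T) u v) ->
  forall v, visits (rotor_walk tgt e s) M v <= u v.
Proof.
move=> hT he hu; set x := rotor_walk tgt e s; elim=> [|m IHm] hM v; first by rewrite /visits big_ord0.
have {}IHm := IHm (fun k km => hM k (leqW km)).
rewrite visitsS; case: eqP => [xm|_]; last by rewrite addn0.
rewrite addn1 ltn_neqAle IHm andbT; apply/eqP => cv.
have fin w : inflow tgt e u w = inflow tgt e (visits x m) w
    + \sum_z \sum_(visits x m z <= i < u z) (tgt (e z i.+1) == w).
  rewrite -big_split; apply: eq_bigr => z _ /=.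
  by rewrite -!(big_mkord xpredT (fun i => (tgt (e z i.+1) == w) : nat))
             -big_cat_nat.
have := rotor_walk_inflow tgt e s m v; rewrite -/x xm eqxx cv -hu fin.
case: eqP => [<- /eqP|_]; last by lia.
rewrite -{1}[inflow _ _ _ _]addn0 -addnA.
have le : \sum_(z in T) (u z - visits x m z) <=
    \sum_z \sum_(visits x m z <= i < u z) (tgt (e z i.+1) == s).
  rewrite [leqRHS](bigID (mem T)) /=; apply: leq_trans (leq_addr _ _).
  apply: leq_sum => z zT; rewrite -[leqLHS]muln1 -sum_nat_const_nat.
  by apply: leq_sum => i _; rewrite hT ?eqxx // he.
have := hM m (leqnn _); rewrite -subn_gt0 -sumnB //; lia.
Qed.

(** [sigma n] is the time just after the [n]-th hit. Monotonicity of [tau] leaves no visit to [T]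
    between consecutive hits, so counts on [T] change only at hits. *)
Lemma hitting_times (V : finType) (x : nat -> V) (T : {set V}) t :
    is_hitting_sequence x T t ->
  (forall n, 1 <= n -> t n \in T) /\
  exists sigma : nat -> nat,
    [/\ sigma 0 = 0,
        forall n, exists2 m, sigma n.+1 = m.+1 & x m \in T &
        forall n v, v \in T ->
          visits x (sigma n) v = \sum_(k < n) (t k.+1 == v)].
Proof.
case=> tau [mono range ht].
have tauT n : 1 <= n -> x (tau n) \in T by move=> n1; apply/range; exists n.
split=> [n n1|]; first by rewrite ht ?tauT.
pose sigma n := if n is 0 then 0 else (tau n).+1.
exists sigma; split=> // [n|n v vT]; first by exists (tau n.+1); rewrite ?tauT.
elim: n => [|n IHn]; first by rewrite /visits !big_ord0.
rewrite [sigma _]/= visitsS -ht // big_ord_recr /= -IHn; congr (_ + _).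
have le : sigma n <= tau n.+1 by case: n {IHn} => //= n; apply: mono.
rewrite /visits -!(big_mkord xpredT (fun i => (x i == v) : nat)).
rewrite (big_cat_nat (leq0n _) le) /= [X in _ + X]big1_seq ?addn0 // => i.
rewrite mem_index_iota => /andP[_ /andP[ge lt]]; case: eqP => // xi.
have [k k1 tk] : exists2 k, 1 <= k & tau k = i by apply/range; rewrite xi.
have [kn|nk|kn] := ltngtP k n.+1; last by move: lt; rewrite -tk kn ltnn.
  case: n {IHn le lt} ge kn => [|n] ge kn; first by case: k k1 kn {tk}.
  move: ge; rewrite /sigma -tk ltnNge; case/negP.
  by move: kn; rewrite ltnS leq_eqVlt => /orP[/eqP->//|/(mono _ _ k1)/ltnW].
by have := mono _ _ (ltn0Sn n) nk; lia.
Qed.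

(** * Large circulations made of full turns *)

Lemma infinitely_often (F : finType) (f : nat -> F) :
  exists y, forall N, exists2 n, N <= n & f n = y.
Proof.
apply: Classical_Prop.NNPP => Hno.
have HB y : exists N, forall n, N <= n -> f n != y.
  apply: Classical_Prop.NNPP => Hy; apply: Hno; exists y => N.
  apply: Classical_Prop.NNPP => HN; apply: Hy; exists N => n le.
  by apply/eqP => fn; apply: HN; exists n.
have [B HBB] := fin_all_exists HB.
have := HBB (f (\max_y B y)) (\max_y B y).
by rewrite eqxx => /(_ (leq_bigmax _)).
Qed.

Lemma mechanism_src (V E : finType) (src : E -> V) e v i :
  rotor_mechanism src e -> 0 < outdeg src v -> src (e v i.+1) = v.
Proof.
move=> he d0; have [Hp Hper] := he v.
elim/ltn_ind: i => i IHi.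
have [id|di] := ltnP i (outdeg src v); last first.
  by rewrite -(subnK di) -addSn Hper // IHi //; lia.
have : e v i.+1 \in [seq e v i | i <- iota 1 (outdeg src v)].
  by apply: map_f; rewrite mem_iota; lia.
by rewrite (perm_mem Hp) mem_enum inE => /eqP.
Qed.

(** The arc [a] excludes a lone vertex without arcs. A path from [v] to [src a] starts with an arc
    leaving [v], unless it is empty and [a] itself leaves [v]. *)
Lemma outdeg_gt0 (V E : finType) (src tgt : E -> V) (a : E) v :
  strongly_connected src tgt -> 0 < outdeg src v.
Proof.
move=> hG; apply/card_gt0P; have /connectP[[|w p] /=] := hG v (src a).
  by move=> _ av; exists a; rewrite inE av.
by case/andP=> /existsP[b /andP[bv _]] _ _; exists b; rewrite inE.
Qed.

Lemma mechanism_periodic (V E : finType) (src : E -> V) e v W i :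
    rotor_mechanism src e -> outdeg src v %| W ->
  e v (i.+1 + W) = e v i.+1.
Proof.
move=> he /dvdnP[k ->]; have [_ Hper] := he v.
elim: k => [|k IHk]; first by rewrite addn0.
by rewrite mulSn addnCA addnC Hper // addSn.
Qed.

Lemma large_circulation (V E : finType) (src tgt : E -> V) (s : V) e D
    (B : V -> nat) :
    strongly_connected src tgt -> rotor_mechanism src e -> 0 < D ->
  exists W : V -> nat,
    [/\ forall v, inflow tgt e W v = W v,
        forall v, outdeg src v %| W v,
        forall v, D %| W v &
        forall v, B v <= W v].
Proof.
move=> hG he D0; set x := rotor_walk tgt e s.
(* Visit counts are recorded modulo [Q.+1], a multiple of [D] and of every out-degree; the successor
   form makes ['I_Q.+1] inhabited for [inord]. *)
pose Q := (D * \prod_v outdeg src v).-1.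
have QE : Q.+1 = D * \prod_v outdeg src v.
  rewrite prednK // muln_gt0 D0 prodn_gt0 // => v.
  exact: outdeg_gt0 (e s 0) _ hG.
pose state m := (x m, [ffun v => inord (visits x m v %% Q.+1) : 'I_Q.+1]).
have [y Hy] := infinitely_often state.
have [m _ ym] := Hy 0.
(* By recurrence, the state can be made to repeat so late that each [v] has gained [B v] visits. *)
have HN v : exists N, B v + visits x m v <= visits x N v.
  have := @count_unbounded _ x v (B v + visits x m v).
  case=> [M|n]; first exact: rotor_walk_recurrent hG he v M.
  by rewrite count_mem_visits; exists n.
have [N HNN] := fin_all_exists HN.
have [n nM yn] := Hy (\max_v N v).
have BW v : B v + visits x m v <= visits x n v.
  by apply: leq_trans (HNN v) (leq_visits _ _ (leq_trans (leq_bigmax v) nM)).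
have le v : visits x m v <= visits x n v by have := BW v; lia.
have [xE /ffunP vE] : x n = x m /\ (state n).2 = (state m).2.
  by have := etrans yn (esym ym); rewrite /state => -[-> ->].
have QW v : Q.+1 %| visits x n v - visits x m v.
  have := congr1 val (vE v); rewrite !ffunE /= !inordK ?ltn_pmod //.
  by move/eqP; rewrite eqn_mod_dvd.
have dW v : outdeg src v %| visits x n v - visits x m v.
  apply: dvdn_trans (QW v).
  by rewrite QE (bigD1 v) //= mulnCA dvdn_mulr.
exists (fun v => visits x n v - visits x m v).
split=> // [v|v|v]; last by have := BW v; lia.
  have := rotor_walk_inflow tgt e s n v; have := rotor_walk_inflow tgt e s m v.
  rewrite -/x xE.
  suff -> : inflow tgt e (visits x n) v = inflow tgt e (visits x m) v +
      inflow tgt e (fun v => visits x n v - visits x m v) v.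
    have := le v; lia.
  rewrite -big_split; apply: eq_bigr => w _ /=; rewrite addnC.
  (* Splitting off the difference in front shifts the other [visits x m w] arcs by full turns, which
     leaves them unchanged. *)
  rewrite (sum_ord_subn (fun i => (tgt (e w i.+1) == v) : nat) (le w)).
  congr (_ + _).
  apply: eq_bigr => i _.
  by rewrite -addnS addnC (mechanism_periodic _ he (dW w)).
by apply: dvdn_trans (QW v); rewrite QE dvdn_mulr.
Qed.

(** * Reversal as complementation in full turns *)

Lemma reversed_mechanism_complement (V E : finType) (src : E -> V) e v W j :
    rotor_mechanism src e -> outdeg src v %| W -> j < W ->
  reversed_mechanism src e v j.+1 = e v (W - j).
Proof.
move=> he /dvdnP[k ->]; rewrite /reversed_mechanism; set d := outdeg src v.
move=> jW; rewrite subn1 /= !addn1 subSS.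
have d0 : 0 < d by move: jW; case: (d) => //; rewrite muln0.
have jd : j %/ d < k by rewrite ltn_divLR.
have rd : j %% d < d by rewrite ltn_mod.
(* Dividing [j] by [d] shows that reading [k] turns backwards reverses each turn separately. The
   form [.-1.+1] is the one [mechanism_periodic] expects. *)
have -> : k * d - j = (d - j %% d).-1.+1 + (k - (j %/ d).+1) * d.
  rewrite {1}(divn_eq j d) mulnBl mulSn.
  have : (j %/ d).+1 * d <= k * d by rewrite leq_mul2r jd orbT.
  rewrite mulSn; lia.
rewrite (mechanism_periodic _ he) ?dvdn_mull // prednK; first by congr e; lia.
by rewrite subn_gt0.
Qed.

Lemma inflow_complement (V E : finType) (src tgt : E -> V) e (W u : V -> nat) v :
    rotor_mechanism src e -> (forall w, outdeg src w %| W w) ->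
    (forall w, u w <= W w) ->
  inflow tgt e (fun w => W w - u w) v +
    inflow tgt (reversed_mechanism src e) u v = inflow tgt e W v.
Proof.
move=> he dW uW; rewrite -big_split; apply: eq_bigr => w _ /=.
rewrite [RHS](sum_ord_subn (fun i => (tgt (e w i.+1) == v) : nat) (uW w)).
congr (_ + _).
rewrite [RHS](reindex_inj rev_ord_inj); apply: eq_bigr => i _ /=.
have iu := ltn_ord i; rewrite (reversed_mechanism_complement he (dW w)).
  by congr (nat_of_bool (tgt (e w _) == v)); have := uW w; lia.
by have := uW w; lia.
Qed.

(** * Circulations and hit counts *)

Lemma sum_hits (V : finType) (T : {set V}) (t : nat -> V) n :
    (forall k, 1 <= k -> t k \in T) ->
  \sum_(v in T) \sum_(k < n) (t k.+1 == v) = n.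
Proof.
move=> tT; rewrite exchange_big /=.
rewrite (eq_bigr (fun=> 1)) ?sum1_card ?card_ord // => k _.
rewrite -[RHS](sum_pointwise (fun=> 1) (tT k.+1 isT)).
by apply: eq_bigr => v _; rewrite muln1.
Qed.

(** The walk stopped at [sigma n] lies below [u] pointwise and has the same total on [T], which
    forces equality there. *)
Lemma circulation_hits (V E : finType) (src tgt : E -> V) s (T : {set V})
    e t (u : V -> nat) n :
    strongly_connected src tgt -> (forall a, src a \in T -> tgt a = s) ->
    rotor_mechanism src e ->
    is_hitting_sequence (rotor_walk tgt e s) T t ->
    (forall v, inflow tgt e u v = u v) -> \sum_(v in T) u v = n ->
  forall v, v \in T -> u v = \sum_(k < n) (t k.+1 == v).
Proof.
move=> hG hT he /hitting_times[tT [sigma [sig0 sigS sigE]]] hu un.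
have hsrc v i : src (e v i.+1) = v.
  by rewrite (mechanism_src _ he) // (outdeg_gt0 (e v 0) _ hG).
set x := rotor_walk tgt e s in sigS sigE.
have sumE : \sum_(v in T) visits x (sigma n) v = n.
  by rewrite -[RHS](sum_hits n tT); apply: eq_bigr => v; apply: sigE.
have le v : visits x (sigma n) v <= u v.
  apply: (visits_le_circulation hT hsrc hu) => m.
  (* The last step before [sigma n] is a hit, so every earlier time has mass below [n] on [T]. *)
  rewrite un; case: n {un} sumE => [|n]; first by rewrite sig0.
  have [M -> xM] := sigS n; rewrite ltnS => sumE mM; rewrite -[ltnRHS]sumE.
  rewrite (bigD1 (x M)) //= [ltnRHS](bigD1 (x M)) //= visitsS eqxx addn1 addSn.
  rewrite ltnS leq_add ?leq_visits //.
  by apply: leq_sum => w _; apply: leq_visits (leqW mM).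
move=> v vT; rewrite -sigE //.
have : \sum_(v in T) (u v - visits x (sigma n) v) = 0.
  by rewrite sumnB // un sumE subnn.
move/eqP; rewrite sum_nat_eq0 => /forall_inP/(_ v vT); have := le v; lia.
Qed.

(** Just after a hit the walk is back at [s], so the two end terms of [rotor_walk_inflow] cancel. *)
Lemma hits_circulation (V E : finType) (src tgt : E -> V) s (T : {set V})
    e t n :
    strongly_connected src tgt -> (forall a, src a \in T -> tgt a = s) ->
    rotor_mechanism src e ->
    is_hitting_sequence (rotor_walk tgt e s) T t ->
  exists u : V -> nat, (forall v, inflow tgt e u v = u v) /\
    forall v, v \in T -> u v = \sum_(k < n) (t k.+1 == v).
Proof.
move=> hG hT he /hitting_times[tT [sigma [sig0 sigS sigE]]].
exists (visits (rotor_walk tgt e s) (sigma n)); split; last by exact: sigE.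
move=> v; have := rotor_walk_inflow tgt e s (sigma n) v.
suff -> : rotor_walk tgt e s (sigma n) = s by move/addIn.
case: n => [|n]; first by rewrite sig0.
have [m -> xm] := sigS n; rewrite rotor_walkS; apply: hT.
rewrite count_mem_visits visitsS eqxx addn1 mechanism_src //.
exact: outdeg_gt0 (e s 0) _ hG.
Qed.

Lemma reversed_hits (V E : finType) (src tgt : E -> V) s (T : {set V}) e t t'
    D B :
    strongly_connected src tgt -> (forall a, src a \in T -> tgt a = s) ->
    rotor_mechanism src e ->
    is_hitting_sequence (rotor_walk tgt e s) T t ->
    is_hitting_sequence (rotor_walk tgt (reversed_mechanism src e) s) T t' ->
    0 < D ->
  exists N, [/\ B <= N, D %| N &
    forall n, 1 <= n <= B -> t' n = t (N + 1 - n)].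
Proof.
move=> hG hT he ht ht' D0; have he' := reversed_mechanismP he.
have [tT _] := hitting_times ht; have [tT' _] := hitting_times ht'.
(* A single [W] must dominate the reversed circulations for all [n <= B], so that one [N] serves
   them all. *)
have [u_ Hu] := fin_all_exists (fun n : 'I_B.+1 =>
  hits_circulation n hG hT he' ht').
have [W [hW dW DW BW]] := large_circulation s (fun v => \max_n u_ n v) hG he D0.
have uW n v : u_ n v <= W v by apply: leq_trans (BW v); apply: leq_bigmax.
pose N := \sum_(v in T) W v.
have sumu n : \sum_(v in T) u_ n v = n.
  by rewrite -[RHS](sum_hits n tT'); apply: eq_bigr => v; apply: (Hu n).2.
have BN : B <= N.
  by rewrite -[leqLHS]/(ord_max : nat) -[leqLHS]sumu; apply: leq_sum.
exists N; split=> // [|n /andP[n1 nB]].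
  by apply: dvdn_sum.
have key m v : m <= B -> v \in T ->
    \sum_(k < N - m) (t k.+1 == v) + \sum_(k < m) (t' k.+1 == v) = W v.
  move=> mB vT; pose m' : 'I_B.+1 := Ordinal (mB : m < B.+1).
  have hc w : inflow tgt e (fun w => W w - u_ m' w) w = W w - u_ m' w.
    have := inflow_complement tgt w he dW (uW m').
    by rewrite hW (Hu m').1 => <-; rewrite addnK.
  have sumc : \sum_(w in T) (W w - u_ m' w) = N - m.
    by rewrite sumnB ?sumu.
  rewrite -(circulation_hits hG hT he ht hc sumc) //.
  by rewrite -((Hu m').2 v vT) subnK.
case: n n1 nB => // n _ nB.
(* From [n] to [n.+1], the count at [t' n.+1] gains one reversed hit, so it must lose an original
   one: the hit dropped is [t (N - n)]. *)
have := key n (t' n.+1) (ltnW nB) (tT' n.+1 isT).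
rewrite -(key n.+1 (t' n.+1) nB (tT' n.+1 isT)).
have -> : N - n = (N - n.+1).+1 by lia.
have -> : N + 1 - n.+1 = (N - n.+1).+1 by lia.
by rewrite !big_ord_recr /= eqxx; case: eqP => // _; lia.
Qed.

Theorem theorem2 (V E : finType) (src tgt : E -> V) (s : V) (T : {set V})
  (hG : strongly_connected src tgt)
  (hT0 : T != set0)
  (hT : forall a : E, src a \in T -> tgt a = s)
  (e : V -> nat -> E) (he : rotor_mechanism src e)
  (t t' : nat -> V)
  (ht : is_hitting_sequence (rotor_walk tgt e s) T t)
  (ht' : is_hitting_sequence
           (rotor_walk tgt (reversed_mechanism src e) s) T t')
  (D : nat) (hD : 1 <= D)
  (hper : forall n : nat, 1 <= n -> t (n + D) = t n) :
  (forall n : nat, 1 <= n -> t' (n + D) = t' n) /\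
  (forall i : nat, 1 <= i <= D -> t' i = t (D + 1 - i)).
Proof.
split=> [n n1|i /andP[i1 iD]].
  (* With this bound one [N] covers both [n] and [n + D], whose mirror images differ by [D]. *)
  have [N [BN _ tE]] := reversed_hits (n + D) hG hT he ht ht' hD.
  rewrite !tE; try lia.
  by rewrite -hper; [congr t|]; lia.
have [N [BN /dvdnP[k NE] tE]] := reversed_hits D hG hT he ht ht' hD.
(* [k = 0] would give [N = 0], against [D <= N]. *)
rewrite tE ?i1 // NE; case: k NE => [|k] NE; first by lia.
have -> : k.+1 * D + 1 - i = D + 1 - i + k * D by rewrite mulSn; lia.
elim: k {NE} => [|k IHk]; first by rewrite addn0.
by rewrite mulSn addnCA addnC hper //; lia.
Qed.
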